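(* For every $n\ge 1$ there is a bijection between the set $\mathcal{UD}_{2n+1}(4123)$ and the set of standard Young tableaux of shape $(n+1,n,n-1)$.
   Context: A permutation $\pi=\pi_1\cdots\pi_m$ of $[m]=\{1,\ldots,m\}$ is up-down alternating if $\pi_1<\pi_2>\pi_3<\pi_4>\cdots$; it avoids the pattern $4123$ if no subsequence $\pi_{i_1}\pi_{i_2}\pi_{i_3}\pi_{i_4}$ ($i_1<i_2<i_3<i_4$) satisfies $\pi_{i_2}<\pi_{i_3}<\pi_{i_4}<\pi_{i_1}$. $\mathcal{UD}_m(4123)$ is the set of $4123$-avoiding up-down alternating permutations of $[m]$. A standard Young tableau of shape $(\lambda_1,\lambda_2,\lambda_3)$ (with $\lambda_1\ge\lambda_2\ge\lambda_3\ge 0$) is a filling of the left-justified array with $\lambda_i$ boxes in row $i$ by $1,\ldots,\lambda_1+\lambda_2+\lambda_3$, each used once, increasing along rows and down columns. *)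

(* Defs.v *)
From mathcomp Require Import all_boot all_fingroup.

Set Implicit Arguments.
Unset Strict Implicit.
Unset Printing Implicit Defensive.

(* Permutations of [m] are permutations of 'I_m = {0, ..., m - 1}: positions  *)
(* and values are both shifted down by one, so pi_1 < pi_2 is the ascent from *)
(* position 0 to position 1.                                                  *)

Definition up_down (m : nat) (p : {perm 'I_m}) : bool :=
  [forall i : 'I_m, forall j : 'I_m,
     (j == i.+1 :> nat) ==> (if odd i then p j < p i else p i < p j)].

Definition avoids4123 (m : nat) (p : {perm 'I_m}) : bool :=
  ~~ [exists i1 : 'I_m, exists i2 : 'I_m, exists i3 : 'I_m, exists i4 : 'I_m,
        [&& i1 < i2, i2 < i3, i3 < i4,
            p i2 < p i3, p i3 < p i4 & p i4 < p i1]].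

Definition UD4123 (m : nat) : {set {perm 'I_m}} :=
  [set p | up_down p && avoids4123 p].

(* Row i (from 0) of the left-justified array has nth 0 sh i boxes. *)
Definition box (sh : seq nat) : finType :=
  {i : 'I_(size sh) & 'I_(nth 0 sh i)}.

Definition box_row (sh : seq nat) (b : box sh) : nat := tag b.
Definition box_col (sh : seq nat) (b : box sh) : nat := tagged b.

(* The entries 1, ..., N are represented by 0, ..., N - 1. *)
Definition filling (sh : seq nat) : finType := {ffun box sh -> 'I_(sumn sh)}.

Definition each_once (sh : seq nat) (T : filling sh) : bool :=
  [forall k : 'I_(sumn sh), #|[set b | T b == k]| == 1].

Definition row_increasing (sh : seq nat) (T : filling sh) : bool :=
  [forall b : box sh, forall c : box sh,
     (box_row b == box_row c) && (box_col b < box_col c) ==> (T b < T c)].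

Definition col_increasing (sh : seq nat) (T : filling sh) : bool :=
  [forall b : box sh, forall c : box sh,
     (box_col b == box_col c) && (box_row b < box_row c) ==> (T b < T c)].

Definition SYT (sh : seq nat) : {set filling sh} :=
  [set T | [&& each_once T, row_increasing T & col_increasing T]].

(* Main.v *)
(** Read a permutation of odd length from right to left: prepending [x] to a
4123-avoider is allowed iff no 123 lies below [x]. When the current first entry
[q] is a peak, the next valley and peak, prepended as [x] and [y], must satisfy
[x <= q] and [x < y <= q + 2], and all that matters is the pattern of the values
below [q], which avoids 123. Row insertion from right to left turns it into a two-row
tableau, i.e. a ballot word, and the two prepended entries act on it as a
truncation followed by an insertion. Since every insertion can be undone from
exactly one corner, summing over all ballot words of a given shape (a, b) turns
this into a recurrence on shapes. The number of permutations obtained from all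
ballot words of shape (a, b) after [k] double steps is
f(a+k+1, b+k+1, k) + f(a+k, b+k, k+1), where f counts standard Young tableaux;
both sides satisfy the same recurrence because f is harmonic for box removal.
The permutations in question all come from shape (1, 0), where the second term
vanishes. *)

Require Import Defs.
From mathcomp Require Import all_boot all_fingroup zify.

Set Implicit Arguments.
Unset Strict Implicit.
Unset Printing Implicit Defensive.

(** * Lattice words in three letters and their recurrence *)

(* Words are stored backwards: the head is the last letter, and letter i says
   that the corresponding entry of the tableau lies in row i. *)
Fixpoint yam_words (m a b c : nat) : seq (seq nat) :=
  if m is m'.+1 then
    if c <= b <= a then
      (if a is a'.+1 then [seq 0 :: w | w <- yam_words m' a' b c] else [::])
      ++ (if b is b'.+1 then [seq 1 :: w | w <- yam_words m' a b' c] else [::])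
      ++ (if c is c'.+1 then [seq 2 :: w | w <- yam_words m' a b c'] else [::])
    else [::]
  else if [&& a == 0, b == 0 & c == 0] then [:: [::]] else [::].

Definition num_yam (a b c : nat) : nat := size (yam_words (a + b + c) a b c).

Lemma num_yam_out a b c : ~~ (c <= b <= a) -> num_yam a b c = 0.
Proof.
rewrite /num_yam; case E : (a + b + c) => [|m] /= H; last by rewrite (negbTE H).
by case: ifP => //; lia.
Qed.

(** Box removal: the last letter is split off. A removal that leaves no partition contributes 0, so
    no corner condition appears. *)
Lemma num_yam_rec a b c : c <= b <= a.+1 ->
  num_yam a.+1 b c = num_yam a b c + (if b is b'.+1 then num_yam a.+1 b' c else 0)
                 + (if c is c'.+1 then num_yam a.+1 b c' else 0).
Proof.
move=> H; rewrite {1}/num_yam 2!addSn /= H !size_cat size_map addnA.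
congr (_ + _ + _).
  by case: b H => [//|b'] H; rewrite size_map /num_yam; congr (size (yam_words _ _ _ _)); lia.
by case: c H => [//|c'] H; rewrite size_map /num_yam; congr (size (yam_words _ _ _ _)); lia.
Qed.

(** * Sums over ballot words of a fixed shape *)

(* Letter z is true if z lies in the first row of the two-row tableau. *)
Fixpoint ballots (m a b : nat) : seq (seq bool) :=
  if m is m'.+1 then
    if b <= a then
      (if a is a'.+1 then [seq rcons w true | w <- ballots m' a' b] else [::])
      ++ (if b is b'.+1 then [seq rcons w false | w <- ballots m' a b'] else [::])
    else [::]
  else if (a == 0) && (b == 0) then [:: [::]] else [::].

Definition bsum (a b : nat) (g : seq bool -> nat) : nat :=
  \sum_(w <- ballots (a + b) a b) g w.

Lemma eq_bsum a b g h : g =1 h -> bsum a b g = bsum a b h.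
Proof. by move=> E; apply: eq_bigr => w _; apply: E. Qed.

Lemma bsumD a b g h : bsum a b (fun w => g w + h w) = bsum a b g + bsum a b h.
Proof. exact: big_split. Qed.

Lemma bsum_out a b g : a < b -> bsum a b g = 0.
Proof.
rewrite /bsum; case E : (a + b) => [|m] /= H; first by lia.
by rewrite leqNgt H big_nil.
Qed.

Lemma bsum00 g : bsum 0 0 g = g [::].
Proof. by rewrite /bsum /= big_seq1. Qed.

Lemma bsum_rec a b g : b <= a.+1 ->
  bsum a.+1 b g = bsum a b (fun w => g (rcons w true))
                 + (if b is b'.+1 then bsum a.+1 b' (fun w => g (rcons w false)) else 0).
Proof.
move=> H; rewrite {1}/bsum addSn /= H big_cat big_map; congr (_ + _).
case: b H => [|b'] H; first by rewrite big_nil.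
by rewrite big_map /bsum; congr (\sum_(w <- ballots _ _ _) _); lia.
Qed.

(** * Row insertion into two-row tableaux *)

Fixpoint lower_first (v : seq bool) : seq bool :=
  if v is t :: v' then (if t then false :: v' else false :: lower_first v') else [::].

(* Schensted insertion of the value x: the next larger entry of the first row is
   bumped to the second row. *)
Definition insert (x : nat) (w : seq bool) : seq bool :=
  take x w ++ true :: lower_first (drop x w).

(** No first-row entry is left to bump, so the new box ends the first row. *)
Definition row1_sum (g : seq bool -> nat) (w : seq bool) : nat :=
  \sum_(x < (size w).+1) (true \notin drop x w) * g (insert x w).

(** Sortedness for [implb] says that the letters from [x] on are falses followed by trues: the
    bumped entry then exceeds the whole second row and is appended to it. *)
Definition row2_sum (g : seq bool -> nat) (w : seq bool) : nat :=
  \sum_(x < (size w).+1)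
     (sorted implb (drop x w) && (true \in drop x w)) * g (insert x w).

Lemma lower_first_rcons v t :
  lower_first (rcons v t) = rcons (lower_first v) (if true \in v then t else false).
Proof.
elim: v => [|s v IH] /=; first by case: t.
by case: s; rewrite /= ?IH // inE.
Qed.

Lemma insert_rcons x w t : x <= size w ->
  insert x (rcons w t) = rcons (insert x w) (if true \in drop x w then t else false).
Proof.
move=> H; rewrite /insert drop_rcons // lower_first_rcons -rcons_cons -rcons_cat.
congr (rcons (_ ++ _) _).
by rewrite -cats1 takel_cat.
Qed.

Lemma insert_size w : insert (size w) w = rcons w true.
Proof. by rewrite /insert take_size drop_size /= cats1. Qed.

Lemma sorted_rcons_true v : sorted implb (rcons v true) = sorted implb v.
Proof. by case: v => [|s v] //=; rewrite rcons_path implybT andbT. Qed.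

Lemma sorted_rcons_false v :
  sorted implb (rcons v false) = (true \notin v).
Proof.
case: v => [|s v] //=; elim: v s => [|t v IH] s /=; first by case: s.
by rewrite IH !inE; case: s; case: t.
Qed.

Lemma sorted_notin v : true \notin v -> sorted implb v.
Proof. by rewrite -sorted_rcons_false -cats1 => /cat_sorted2[]. Qed.

Lemma row1_sum_true g w :
  row1_sum g (rcons w true) = g (rcons (rcons w true) true).
Proof.
rewrite /row1_sum size_rcons big_ord_recr /= -[in insert _ _](size_rcons w true).
rewrite insert_size -[in drop _ _](size_rcons w true) drop_size mul1n big1 // => x _.
by rewrite drop_rcons ?mem_rcons ?inE // -ltnS.
Qed.

Lemma row1_sum_false g w :
  row1_sum g (rcons w false)
    = g (rcons (rcons w false) true) + row1_sum (fun v => g (rcons v false)) w.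
Proof.
rewrite /row1_sum size_rcons big_ord_recr /= -[in insert _ _](size_rcons w false).
rewrite insert_size -[in drop _ _](size_rcons w false) drop_size mul1n addnC.
congr (_ + _); apply: eq_bigr => x _.
have Hx : x <= size w by rewrite -ltnS.
rewrite drop_rcons // mem_rcons inE /= insert_rcons //.
by case: (true \in drop x w).
Qed.

(** If a first-row entry from [x] on precedes the last one, it is the one bumped and the last letter
    stays; otherwise the last letter itself is bumped, which gives the [row1_sum] term. *)
Lemma row2_sum_true g w :
  row2_sum g (rcons w true)
    = row2_sum (fun v => g (rcons v true)) w
      + row1_sum (fun v => g (rcons v false)) w.
Proof.
rewrite /row2_sum /row1_sum size_rcons big_ord_recr /=.
rewrite -[in drop _ _](size_rcons w true) drop_size /= addn0 -big_split /=.
apply: eq_bigr => x _; have Hx : x <= size w by rewrite -ltnS.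
rewrite drop_rcons // mem_rcons inE /= andbT sorted_rcons_true insert_rcons //.
case E: (true \in drop x w); rewrite ?andbT ?andbF ?addn0 //.
by rewrite sorted_notin ?E.
Qed.

Lemma row2_sum_false g w : row2_sum g (rcons w false) = 0.
Proof.
rewrite /row2_sum size_rcons big_ord_recr /=.
rewrite -[in drop _ _](size_rcons w false) drop_size /= addn0 big1 // => x _.
rewrite drop_rcons ?mem_rcons ?inE /= ?sorted_rcons_false; last by rewrite -ltnS.
by case: (true \in _).
Qed.

(** Inverse row insertion: since b <= a, the first row of (a+1, b) ends in a corner, and removing it
    undoes exactly one insertion that bumps nothing. *)
Lemma bsum_row1 a b g : b <= a -> bsum a b (row1_sum g) = bsum a.+1 b g.
Proof.
move: {2}(a + b) (leqnn (a + b)) => m; elim: m a b g => [|m IH] a b g Hm Hb.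
  have [-> ->] : a = 0 /\ b = 0 by lia.
  by rewrite bsum_rec // !bsum00 /row1_sum big_ord1 mul1n addn0.
case: a Hm Hb => [|a] Hm Hb.
  have -> : b = 0 by lia.
  by rewrite bsum_rec // !bsum00 /row1_sum big_ord1 mul1n addn0.
(* The right-hand side is split by its last letter, and the words ending in true also by the letter
   before it, to match [row1_sum_true] and [row1_sum_false]. *)
rewrite bsum_rec // [RHS]bsum_rec ?(leqW Hb) // [X in _ = X + _]bsum_rec //.
rewrite -addnA; congr (_ + _).
  by apply: eq_bsum => w; rewrite row1_sum_true.
case: b Hm Hb => [|b] Hm Hb //.
rewrite /= -(IH a.+1 b _ ltac:(lia) ltac:(lia)).
by rewrite -bsumD; apply: eq_bsum => w; rewrite row1_sum_false.
Qed.

(** The same inversion from the corner of the second row of (a, b+1). For a = b there is no such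
    shape and both sides vanish. *)
Lemma bsum_row2 a b g : b <= a -> bsum a b (row2_sum g) = bsum a b.+1 g.
Proof.
move: {2}(a + b) (leqnn (a + b)) => m; elim: m a b g => [|m IH] a b g Hm Hb.
  have [-> ->] : a = 0 /\ b = 0 by lia.
  by rewrite [RHS]bsum_out // bsum00 /row2_sum big_ord1.
case: a Hm Hb => [|a] Hm Hb.
  have -> : b = 0 by lia.
  by rewrite [RHS]bsum_out // bsum00 /row2_sum big_ord1.
rewrite bsum_rec //.
have -> : (if b is b'.+1 then
    bsum a.+1 b' (fun w => row2_sum g (rcons w false)) else 0) = 0.
  by case: b {Hm Hb} => // b; apply: big1 => w _; rewrite row2_sum_false.
rewrite addn0 (eq_bsum _ _ (row2_sum_true g)) bsumD.
have [Hab|Hab] := leqP b a; last by rewrite !bsum_out.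
by rewrite IH ?bsum_row1 ?[RHS]bsum_rec //; lia.
Qed.

(** * The number of descendants after [k] double steps *)

(** One double step. The appended true is the letter of the current peak, and the new word is
    [insert x (take j (rcons w true))]. The case [j = (size w).+1] stands apart: [x] cannot exceed
    the current peak, so there the insertion always bumps. *)
Definition child_sum (g : seq bool -> nat) (w : seq bool) : nat :=
  row2_sum g (rcons w true)
  + \sum_(j < (size w).+1) (row1_sum g (take j w) + row2_sum g (take j w)).

(** The last entry to be prepended is a valley, which only has to be at most the relative value
    [size w] of the current peak. *)
Fixpoint num_desc (k : nat) (w : seq bool) : nat :=
  if k is k'.+1 then child_sum (num_desc k') w else (size w).+1.

Lemma bsum_row2_true a b g : b <= a ->
  bsum a b (fun w => row2_sum g (rcons w true)) = bsum a.+1 b.+1 g.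
Proof.
move=> H; rewrite (eq_bsum _ _ (row2_sum_true g)) bsumD bsum_row1 // bsum_row2 //.
by rewrite [RHS]bsum_rec.
Qed.

Definition prefix_sum (h : seq bool -> nat) (w : seq bool) : nat :=
  \sum_(j < (size w).+1) h (take j w).

Lemma prefix_sum_rcons h w t :
  prefix_sum h (rcons w t) = h (rcons w t) + prefix_sum h w.
Proof.
rewrite /prefix_sum size_rcons big_ord_recr /= addnC; congr (_ + _).
  by rewrite -{1}(size_rcons w t) take_size.
by apply: eq_bigr => j _; rewrite -cats1 takel_cat // -ltnS.
Qed.

(** A prefix is the whole word or a prefix of the word without its last letter. *)
Lemma bsum_prefix_rec a b h : b <= a.+1 ->
  bsum a.+1 b (prefix_sum h)
    = bsum a.+1 b h + bsum a b (prefix_sum h)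
      + (if b is b'.+1 then bsum a.+1 b' (prefix_sum h) else 0).
Proof.
move=> H; rewrite bsum_rec // (eq_bsum _ _ (fun w => prefix_sum_rcons h w true)).
rewrite bsumD [bsum a.+1 b h]bsum_rec //.
case: b H => [|b] H; first by rewrite !addn0.
by rewrite (eq_bsum _ _ (fun w => prefix_sum_rcons h w false)) bsumD; lia.
Qed.

Lemma bsum_prefix00 h : bsum 0 0 (prefix_sum h) = h [::].
Proof. by rewrite bsum00 /prefix_sum big_ord1. Qed.

Lemma bsum_size a b h :
  bsum a b (fun w => (size w).+1 * h w) = (a + b).+1 * bsum a b h.
Proof.
rewrite /bsum.
have : forall m, m = a + b -> {in ballots m a b, forall w, size w = m}.
  move=> m; elim: m a b => [|m IH] a b E w /=.
    by case: ifP => // _; rewrite inE => /eqP ->.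
  case: ifP => // _; rewrite mem_cat => /orP[].
    case: a E => // a E /mapP[v Hv ->]; rewrite size_rcons (IH a b) //; lia.
  case: b E => // b E /mapP[v Hv ->]; rewrite size_rcons (IH a b) //; lia.
move=> /(_ _ erefl) H; rewrite big_distrr /= !big_seq.
by apply: eq_bigr => w /H ->.
Qed.

Lemma bsum_card a b : bsum a b (fun=> 1) = num_yam a b 0.
Proof.
move: {2}(a + b) (leqnn (a + b)) => m; elim: m a b => [|m IH] a b Hm.
  have [-> ->] : a = 0 /\ b = 0 by lia.
  by rewrite bsum00.
have [H|H] := leqP b a; last by rewrite bsum_out // num_yam_out //; lia.
case: a Hm H => [|a] Hm H.
  have -> : b = 0 by lia.
  by rewrite bsum00.
rewrite bsum_rec // num_yam_rec //= IH; last lia.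
by case: b Hm H => [|b] Hm H; rewrite ?IH //; lia.
Qed.

(** For a shape of size m, m+1 times its count is the sum of the counts over all ways to add a box;
    box removal merges the terms (a+1, b, 0) and (a, b+1, 0) into (a+1, b+1, 0). This is the case k
    = 0 of [bsum_num_desc]. *)
Lemma num_yam_marked a b : b <= a ->
  (a + b).+1 * num_yam a b 0 = num_yam a.+1 b.+1 0 + num_yam a b 1.
Proof.
move: {2}(a + b) (leqnn (a + b)) => m; elim: m a b => [|m IH] a b Hm Hb.
  by have [-> ->] : a = 0 /\ b = 0 by lia.
case: a Hm Hb => [|a] Hm Hb; first by have -> : b = 0 by lia.
rewrite [num_yam a.+2 _ _]num_yam_rec //= addn0.
case: b Hm Hb => [|b] Hm Hb.
  have E c : num_yam c.+1 0 0 = num_yam c 0 0 by rewrite num_yam_rec // !addn0.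
  have := IH a 0 ltac:(lia) isT; rewrite !(@num_yam_out _ 0 1) ?andbF //= !E.
  by lia.
have H2 := IH a.+1 b ltac:(lia) ltac:(lia).
have -> : (a.+1 + b.+1).+1 = (a + b).+2.+1 by lia.
rewrite [in X in X = _]num_yam_rec //= [num_yam a.+1 b.+1 1]num_yam_rec ?ltnS //= addn0.
have E1 : (a.+1 + b).+1 = (a + b).+2 by lia.
rewrite E1 in H2; rewrite mulSn mulnDr {}H2.
have [H|H] := leqP b.+1 a.
  have H1 := IH a b.+1 ltac:(lia) H.
  have E2 : (a + b.+1).+1 = (a + b).+2 by lia.
  rewrite E2 in H1; rewrite {}H1 [num_yam a.+1 b.+1 0]num_yam_rec //=.
  by lia.
rewrite [num_yam a.+1 b.+1 0]num_yam_rec //= !(@num_yam_out a b.+1) ?(@num_yam_out a.+1 b.+2); lia.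
Qed.

Lemma bsum_child_prefix a b g : b <= a ->
  bsum a b (fun w => row1_sum g w + row2_sum g w) = bsum a.+1 b g + bsum a b.+1 g.
Proof. by move=> H; rewrite bsumD bsum_row1 // bsum_row2. Qed.

(* Writing x_i for the shift of the i-th row length, the right-hand side is
   x_3 (x_1 + x_2) (x_1 x_2 + x_3) applied to the tableau count; the correction for
   b = 0 is the value -f at the reflected point (a+k+1, k, k+2). *)
Lemma bsum_prefix_formula k g : (forall a b, b <= a ->
    bsum a b g = num_yam (a + k).+1 (b + k).+1 k + num_yam (a + k) (b + k) k.+1) ->
  forall a b, b <= a ->
  bsum a b (prefix_sum (fun w => row1_sum g w + row2_sum g w))
    + (b == 0) * num_yam (a + k).+1 k.+1 k.+1
  = num_yam (a + k).+2 (b + k).+1 k.+1 + num_yam (a + k).+1 (b + k).+2 k.+1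
    + num_yam (a + k).+1 (b + k) k.+2 + num_yam (a + k) (b + k).+1 k.+2.
Proof.
move=> Hg a b; set h := fun w => _.
have Hh c d : d <= c -> bsum c d h =
    num_yam (c + k).+2 (d + k).+1 k + num_yam (c + k).+1 (d + k) k.+1
    + num_yam (c + k).+1 (d + k).+2 k + num_yam (c + k) (d + k).+1 k.+1.
  move=> Hd; rewrite bsum_child_prefix // Hg; last lia.
  have [H|H] := leqP d.+1 c; first by rewrite Hg // !addSn; lia.
  rewrite [bsum c _ _]bsum_out // !(@num_yam_out (c + k) (d + k).+1); last by lia.
  by rewrite !(@num_yam_out (c + k).+1 (d + k).+2) ?addSn; lia.
move: {2}(a + b) (leqnn (a + b)) => m; elim: m a b => [|m IH] a b Hm Hb.
  have [-> ->] : a = 0 /\ b = 0 by lia.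
  rewrite bsum_prefix00 -bsum00 Hh // !add0n mul1n.
  rewrite !(@num_yam_out k.+1 k.+2) ?(@num_yam_out k k.+1) ?(@num_yam_out k.+1 k k.+1)
    ?(@num_yam_out k.+1 k k.+2); try lia.
  rewrite [num_yam k.+2 k.+1 k.+1]num_yam_rec; last lia.
  by rewrite ?(@num_yam_out k.+2 k k.+1); lia.
case: a Hm Hb => [|a] Hm Hb.
  by apply: IH; lia.
rewrite bsum_prefix_rec // Hh //.
case: b Hm Hb => [|b] Hm Hb.
  have := IH a 0 ltac:(lia) isT; rewrite !add0n !eqxx !mul1n !addSn addn0.
  rewrite !(@num_yam_out _ k k.+1) ?(@num_yam_out _ k k.+2) ?(@num_yam_out _ k.+1 k.+2); try lia.
  rewrite [num_yam (a + k).+3 k.+1 k.+1]num_yam_rec; last lia.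
  rewrite (@num_yam_out _ k k.+1); last lia.
  rewrite [num_yam (a + k).+2 k.+2 k.+1]num_yam_rec; last lia.
  by lia.
have := IH a.+1 b ltac:(lia) ltac:(lia).
have P1 : bsum a b.+1 (prefix_sum h) =
  if b < a then num_yam (a + k).+2 (b + k).+2 k.+1 + num_yam (a + k).+1 (b + k).+3 k.+1
    + num_yam (a + k).+1 (b + k).+1 k.+2 + num_yam (a + k) (b + k).+2 k.+2 else 0.
  case: ifP => H; last by rewrite bsum_out //; lia.
  by have := IH a b.+1 ltac:(lia) H; rewrite !addSn mul0n addn0.
rewrite {}P1 !addSn mul0n addn0.
have Hba : b + k <= a + k by lia.
have Hbk : (b == 0) = (b + k == k) by lia.
have Hlt : (b < a) = (b + k < a + k) by lia.
rewrite {}Hbk {}Hlt; have Hk : k <= b + k by lia.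
move: (a + k) (b + k) Hba Hk => A B Hba Hk.
have E1 := @num_yam_rec A.+2 B.+2 k.+1 ltac:(lia).
have E2 : num_yam A.+2 B.+3 k.+1 = if B < A then num_yam A.+1 B.+3 k.+1 + num_yam A.+2 B.+2 k.+1 +
  num_yam A.+2 B.+3 k else 0.
  by case: ifP => H; [rewrite num_yam_rec | rewrite num_yam_out]; lia.
have E3 : num_yam A.+2 B.+1 k.+2 = if k < B then num_yam A.+1 B.+1 k.+2 + num_yam A.+2 B k.+2 +
  num_yam A.+2 B.+1 k.+1 else 0.
  by case: ifP => H; [rewrite num_yam_rec | rewrite num_yam_out]; lia.
have E4 : num_yam A.+1 B.+2 k.+2 = if B < A then num_yam A B.+2 k.+2 + num_yam A.+1 B.+1 k.+2 +
  num_yam A.+1 B.+2 k.+1 else 0.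
  by case: ifP => H; [rewrite num_yam_rec | rewrite num_yam_out]; lia.
rewrite E1 E2 E3 E4 /= => {E1 E2 E3 E4}.
(* The cases are whether the rows of (a+1, b+1) are equal, so that shortening the first leaves no
   ballot word, and whether b = 0, so that shortening the second meets the correction term. *)
have [H1|H1] := ltnP B A; have [H2|H2] := ltnP k B.
- have -> : (B == k) = false by lia.
  by lia.
- have -> : B = k by lia.
  by rewrite eqxx !(@num_yam_out _ k) ?(@num_yam_out _ k.+1 k.+2); lia.
- have -> : B = A by lia.
  have -> : (A == k) = false by lia.
  by rewrite !(@num_yam_out A.+1 A.+2) ?(@num_yam_out A.+1 A.+2) ?(@num_yam_out A.+2 A.+3) ; lia.
have -> : B = A by lia.
have -> : A = k by lia.
rewrite eqxx.
by rewrite !(@num_yam_out k.+1 k.+2) ?(@num_yam_out k.+2 k.+3) ?(@num_yam_out _ k.+1 k.+2)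
  ?(@num_yam_out _ k k.+1) ?(@num_yam_out _ k k.+2); lia.
Qed.

(** In the induction step, [bsum_row2_true] and [bsum_prefix_formula] produce six terms and a
    correction; box removal from the two shapes on the right yields the same terms. *)
Lemma bsum_num_desc k a b : b <= a ->
  bsum a b (num_desc k)
  = num_yam (a + k).+1 (b + k).+1 k + num_yam (a + k) (b + k) k.+1.
Proof.
elim: k a b => [|k IH] a b Hb.
  rewrite !addn0 -num_yam_marked // -bsum_card -bsum_size.
  by apply: eq_bsum => w; rewrite muln1.
rewrite [LHS]bsumD bsum_row2_true // IH //.
have := bsum_prefix_formula IH Hb; rewrite !addSn !addnS.
have Hba : b + k <= a + k by lia.
have Hbk : (b == 0) = (b + k == k) by lia.
rewrite Hbk; have Hk : k <= b + k by lia.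
rewrite /prefix_sum; move: (bsum a b _) => S.
move: (a + k) (b + k) Hba Hk => A B Hba Hk.
rewrite [num_yam A.+2 B.+2 k.+1]num_yam_rec /=; last lia.
have [H|H] := ltnP k B.
  rewrite [num_yam A.+1 B.+1 k.+2]num_yam_rec /=; last lia.
  have -> : (B == k) = false by lia.
  by lia.
(* For b = 0 the triple (a+k+1, k+1, k+2) is no partition and counts 0; the correction cancels the
   remaining term at (a+k+1, k+1, k+1). *)
have -> : B = k by lia.
by rewrite eqxx !(@num_yam_out _ k.+1 k.+2) ?(@num_yam_out _ k k.+2); lia.
Qed.

(** * Patterns in sequences of natural numbers *)

Fixpoint has12 (lo hi : nat) (p : seq nat) : bool :=
  if p is y :: p' then
    (lo <= y) && has (fun z => y < z < hi) p' || has12 lo hi p'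
  else false.

Fixpoint has123 (hi : nat) (p : seq nat) : bool :=
  if p is y :: p' then has12 y.+1 hi p' || has123 hi p' else false.

Fixpoint has4123 (p : seq nat) : bool :=
  if p is y :: p' then has123 y p' || has4123 p' else false.

Lemma has12_map (f : nat -> nat) lo hi lo' hi' p :
    {mono f : x y / x < y} -> (forall y, (lo <= f y) = (lo' <= y)) ->
    (forall y, (f y < hi) = (y < hi')) ->
  has12 lo hi (map f p) = has12 lo' hi' p.
Proof.
move=> Hf Hlo Hhi; elim: p => //= y p ->; rewrite Hlo has_map.
by congr (_ && _ || _); apply: eq_has => z /=; rewrite Hf Hhi.
Qed.

Lemma has123_map (f : nat -> nat) hi hi' p :
    {mono f : x y / x < y} -> (forall y, (f y < hi) = (y < hi')) ->
  has123 hi (map f p) = has123 hi' p.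
Proof.
move=> Hf Hhi; elim: p => //= y p ->.
by congr (_ || _); apply: has12_map => // z; apply: Hf.
Qed.

Lemma has4123_map (f : nat -> nat) p :
  {mono f : x y / x < y} -> has4123 (map f p) = has4123 p.
Proof.
move=> Hf; elim: p => //= y p ->.
by congr (_ || _); apply: has123_map.
Qed.

Lemma has12_empty lo hi p : hi <= lo.+1 -> has12 lo hi p = false.
Proof.
move=> H; elim: p => //= y p ->; rewrite orbF.
by case: leqP => //= Hy; apply/hasP => -[z _]; lia.
Qed.

Lemma has12_le lo hi hi' p : hi <= hi' -> has12 lo hi p -> has12 lo hi' p.
Proof.
move=> H; elim: p => //= y p IH /orP[/andP[-> /= Hh]|/IH ->]; last by rewrite orbT.
by rewrite (sub_has _ Hh) // => z /=; lia.
Qed.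

Lemma has123_le hi hi' p : hi <= hi' -> has123 hi p -> has123 hi' p.
Proof.
move=> H; elim: p => //= y p IH /orP[/(has12_le H) -> //|/IH ->]; exact: orbT.
Qed.

Lemma ltn_bump x : {mono bump x : y z / y < z}.
Proof. by move=> y z; rewrite /bump; lia. Qed.

Lemma has123_cons_ge x v p : v <= x ->
  has123 v (x :: map (bump x) p) = has123 v p.
Proof.
move=> H /=; rewrite has12_empty /=; last lia.
by apply: has123_map; [exact: ltn_bump | rewrite /bump; lia].
Qed.

(** Prepending [x] shifts the values from [x] on by one, hence the bounds [v.+1] and [v]; a new 123
    starts with [x]. *)
Lemma has123_cons_lt x v p : x <= v ->
  has123 v.+1 (x :: map (bump x) p) = has12 x v p || has123 v p.
Proof.
move=> H /=; congr (_ || _).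
  by apply: has12_map; [exact: ltn_bump | rewrite /bump; lia | rewrite /bump; lia].
by apply: has123_map; [exact: ltn_bump | rewrite /bump; lia].
Qed.

Lemma has12_indexP lo hi p : uniq p ->
  reflect (exists y y', [/\ lo <= y, y < y', y' < hi, y' \in p
                           & index y p < index y' p])
          (has12 lo hi p).
Proof.
elim: p => [_|x p IH] /=; first by apply: ReflectF => -[y [y' []]].
case/andP=> Hx Hp; apply: (iffP orP).
  case=> [/andP[Hlo /hasP[z Hz /andP[Hxz Hzh]]]|/(IH Hp)[y [y' [H1 H2 H3 H4 H5]]]].
    exists x, z; rewrite inE Hz orbT eqxx; split=> //.
    by case: eqP => // E; move: Hxz; rewrite E ltnn.
  exists y, y'; rewrite inE H4 orbT; split=> //.
  have Hy : y \in p by rewrite -index_mem (ltn_trans H5) // index_mem.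
  by case: eqP Hx => [->|_]; rewrite ?Hy //; case: eqP => [->|_]; rewrite ?H4.
case=> y [y' [H1 H2 H3]]; rewrite inE eq_sym.
case: eqP => [E|_ /= H4]; first by rewrite E.
case: eqP => [E _|_ H5].
  by left; rewrite E H1; apply/hasP; exists y'; rewrite // H2.
by right; apply/(IH Hp); exists y, y'.
Qed.

(** Along the run of consecutive values between the two entries of a 12, the positions cannot
    decrease at every step. *)
Lemma has12_adjacent lo hi p : uniq p -> (forall y, y < hi -> y \in p) ->
  has12 lo hi p ->
  exists z, [/\ lo <= z, z.+1 < hi & index z p < index z.+1 p].
Proof.
move=> Up Hin /(has12_indexP _ _ Up)[y [y' [H1 H2 H3 _]]].
elim: y' H2 H3 => // y' IH H2 H3 H5.
have [E|Hy] := eqVneq y y'; first by exists y'; rewrite -E in H5 *; split=> //; lia.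
have [H|H] := ltnP (index y p) (index y' p).
  by apply: IH; lia.
have : index y' p < index y'.+1 p by apply: leq_ltn_trans H H5.
by exists y'; split=> //; lia.
Qed.

(** * Insertion codes, their permutations and their words *)

Fixpoint is_code (c : seq nat) : bool :=
  if c is x :: c' then (x <= size c') && is_code c' else true.

(* The entry x of a code is the relative value of the entry prepended last. *)
Fixpoint perm_of_code (c : seq nat) : seq nat :=
  if c is x :: c' then x :: map (bump x) (perm_of_code c') else [::].

Fixpoint word_of_code (c : seq nat) : seq bool :=
  if c is x :: c' then insert x (word_of_code c') else [::].

Lemma perm_of_code_cons x c : perm_of_code (x :: c) = x :: map (bump x) (perm_of_code c).
Proof. by []. Qed.

Lemma word_of_code_cons x c : word_of_code (x :: c) = insert x (word_of_code c).
Proof. by []. Qed.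

Lemma size_perm_of_code c : size (perm_of_code c) = size c.
Proof. by elim: c => //= x c IH; rewrite size_map IH. Qed.

Lemma bump_inj x : injective (bump x).
Proof. exact: can_inj (bumpK x). Qed.

Lemma mem_perm_of_code c y : is_code c -> (y \in perm_of_code c) = (y < size c).
Proof.
elim: c y => //= x c IH y /andP[Hx Hc]; rewrite inE.
have [->|Hy] /= := eqVneq y x; first by rewrite ltnS Hx.
have -> : y = bump x (unbump x y) by rewrite unbumpK // inE.
by rewrite (mem_map (@bump_inj x)) IH //; rewrite /bump /unbump; lia.
Qed.

Lemma uniq_perm_of_code c : uniq (perm_of_code c).
Proof.
elim: c => //= x c IH; rewrite (map_inj_uniq (@bump_inj x)) IH andbT.
by apply/mapP => -[y _]; rewrite /bump; lia.
Qed.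

Lemma size_lower_first v : size (lower_first v) = size v.
Proof. by elim: v => [|[] v IH] //=; rewrite IH. Qed.

Lemma take_lower_first i v : take i (lower_first v) = lower_first (take i v).
Proof. by elim: v i => [|[] v IH] [|i] //=; rewrite IH. Qed.

Lemma size_insert x w : size (insert x w) = (size w).+1.
Proof. by rewrite size_cat /= size_lower_first addnS -size_cat cat_take_drop. Qed.

Lemma size_word_of_code c : size (word_of_code c) = size c.
Proof. by elim: c => //= x c IH; rewrite size_insert IH. Qed.

(** The bumped letter is the first true from [x] on, whatever follows it, so insertion commutes with
    truncation; the letter of [x] itself adds one to the length. *)
Lemma take_insert j x w : x <= j -> x <= size w ->
  take j.+1 (insert x w) = insert x (take j w).
Proof.
move=> H Hx; rewrite /insert take_cat size_takel // ltnNge (leqW H) /= subSn //=.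
by rewrite take_takel // take_lower_first take_drop subnK.
Qed.

Lemma nth_insert d x w i : x <= size w ->
  nth d (insert x w) i = if i < x then nth d w i
                      else if i == x then true
                      else nth d (lower_first (drop x w)) (i - x.+1).
Proof.
move=> H; rewrite /insert nth_cat size_takel //.
case: ltnP => Hi; first by rewrite nth_take.
case: eqP => [->|Hne]; first by rewrite subnn.
by have -> : i - x = (i - x.+1).+1 by lia.
Qed.

(** The default [true] rules out a descent at or beyond the last letter. *)
Definition descent (w : seq bool) z := nth true w z && ~~ nth true w z.+1.

(** The lowered letter is preceded by falses only, so lowering it creates no descent. *)
Lemma descent_lower_first v i : descent (lower_first v) i -> descent v i.
Proof.
by rewrite /descent; elim: v i => [|[] v IH] [|i] //=; apply: IH.
Qed.

Lemma lower_first_head v : 0 < size v -> nth true (lower_first v) 0 = false.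
Proof. by case: v => [|[] v]. Qed.

(* The word records the adjacent ascents of the values lying below any 123. *)
Lemma descent_word_of_code c v z : is_code c -> v <= size c -> ~~ has123 v (perm_of_code c) ->
  z.+1 < v -> descent (word_of_code c) z = (index z (perm_of_code c) < index z.+1 (perm_of_code c)).
Proof.
elim: c v z => [|x c IH] v z /=; first by move=> _; rewrite leqn0 => /eqP ->.
case/andP=> Hx Hc Hv; rewrite -/(has123 v (x :: map (bump x) (perm_of_code c))).
have Hw : x <= size (word_of_code c) by rewrite size_word_of_code.
have ib y : index (bump x y) (map (bump x) (perm_of_code c)) = index y (perm_of_code c).
  by rewrite (index_map (@bump_inj x)).
have ib' y : y < x -> index y (map (bump x) (perm_of_code c)) = index y (perm_of_code c).
  by move=> Hy; rewrite -[RHS]ib; congr index; rewrite /bump; lia.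
have [Hvx|Hxv] := leqP v x.
  rewrite has123_cons_ge // => H3 Hz.
  have := IH v z Hc ltac:(lia) H3 Hz; rewrite /descent !nth_insert //.
  have -> : z < x by lia.
  have -> : z.+1 < x by lia.
  move=> ->; have -> : (x == z) = false by lia.
  have -> : (x == z.+1) = false by lia.
  by rewrite ltnS !ib'; lia.
case: v Hv Hxv => // v Hv Hxv; rewrite has123_cons_lt // negb_or => /andP[Ha H3] Hz.
have IHv y := IH v y Hc ltac:(lia) H3.
rewrite /descent !nth_insert //.
have [Hzx|Hzx] := ltnP z.+1 x.
  have := IHv z ltac:(lia); rewrite /descent.
  have -> : z < x by lia.
  move=> ->; have -> : (x == z) = false by lia.
  have -> : (x == z.+1) = false by lia.
  by rewrite ltnS !ib'; lia.
(* Next to [x] the inserted true decides: [x] has position 0, so its predecessor comes later, and so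
   does its successor. *)
have [<-|Hne] := eqVneq z.+1 x; first by rewrite /= ?eqxx ?andbF ?ltn0.
have [<-|Hne'] := eqVneq z x.
  by rewrite ltnn subnn lower_first_head // size_drop size_word_of_code; lia.
have -> : (z < x) = false by lia.
rewrite ltnS -[RHS]/(index z _ < index z.+1 _).
case: z Hz Hzx Hne Hne' => [|z] Hz Hzx Hne Hne'; first by lia.
have E1 : z.+1 = bump x z by rewrite /bump; lia.
have E2 : z.+2 = bump x z.+1 by rewrite /bump; lia.
have -> : index z.+2 (map (bump x) (perm_of_code c)) = index z.+1 (perm_of_code c) by rewrite E2 ib.
have -> : index z.+1 (map (bump x) (perm_of_code c)) = index z (perm_of_code c) by rewrite E1 ib.
rewrite !subSS.
(* Above [x] both sides are false: an ascent of old consecutive values from [x] on would complete a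
   123 with [x]. *)
have -> : (index z (perm_of_code c) < index z.+1 (perm_of_code c)) = false.
  apply/negbTE; move: Ha; apply: contra => Hi; apply/(has12_indexP _ _ (uniq_perm_of_code c)).
  by exists z, z.+1; rewrite mem_perm_of_code //; split=> //; lia.
apply/negbTE/negP => Hd.
have {}Hd : descent (lower_first (drop x (word_of_code c))) (z - x).
  by move: Hd; rewrite /descent subSn //; lia.
move/descent_lower_first: Hd; rewrite /descent !nth_drop addnS subnKC; last by lia.
rewrite -/(descent (word_of_code c) z) IHv => [Hi|]; last by lia.
case/negP: Ha; apply/(has12_indexP _ _ (uniq_perm_of_code c)).
by exists z, z.+1; rewrite mem_perm_of_code //; split=> //; lia.
Qed.

(** A 12 reduces to two consecutive values by [has12_adjacent], and such ascents are the descents of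
    the word. *)
Lemma has12_word_of_code c lo v : is_code c -> v <= size c -> ~~ has123 v (perm_of_code c) ->
  has12 lo v (perm_of_code c) = ~~ sorted implb (drop lo (take v (word_of_code c))).
Proof.
move=> Hc Hv H3.
have Hs : size (take v (word_of_code c)) = v by rewrite size_takel ?size_word_of_code.
apply/idP/idP => [Ha|].
  have [|z [Hz1 Hz2 Hz3]] := has12_adjacent (uniq_perm_of_code c) _ Ha.
    by move=> y Hy; rewrite mem_perm_of_code //; lia.
  rewrite -(descent_word_of_code Hc Hv H3 Hz2) in Hz3.
  apply/negP => /(sortedP true)/(_ (z - lo)); rewrite size_drop Hs.
  rewrite !nth_drop addnS subnKC // !nth_take; try lia.
  by move/(_ ltac:(lia)); case/andP: Hz3 => -> /negbTE ->.
apply: contraNT => Ha; apply/(sortedP true) => i; rewrite size_drop Hs => Hi.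
rewrite !nth_drop addnS !nth_take; try lia.
apply: contraNT Ha; rewrite negb_imply => Hd; apply/(has12_indexP _ _ (uniq_perm_of_code c)).
exists (lo + i), (lo + i).+1; rewrite mem_perm_of_code // -(descent_word_of_code Hc Hv H3); last
  lia.
by split=> //; lia.
Qed.

(** * Counting the extensions of a code *)

(* The parity is that of a suffix of an up-down permutation of odd length: a
   suffix of odd length starts with a valley. *)
Definition extendable (c : seq nat) (x : nat) : bool :=
  ~~ has123 x (perm_of_code c)
  && (if c is y :: _ then if odd (size c) then y < x else x <= y else true).

Fixpoint num_ext (r : nat) (c : seq nat) : nat :=
  if r is r'.+1 then
    \sum_(0 <= x < (size c).+1) extendable c x * num_ext r' (x :: c)
  else 1.

Lemma num_extS r c :
  num_ext r.+1 c = \sum_(0 <= x < (size c).+1) extendable c x * num_ext r (x :: c).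
Proof. by []. Qed.

Lemma row_sumD g w :
  row1_sum g w + row2_sum g w
    = \sum_(0 <= x < (size w).+1) sorted implb (drop x w) * g (insert x w).
Proof.
rewrite big_mkord -big_split; apply: eq_bigr => x _ /=.
case E : (true \in drop x w); rewrite ?andbT ?andbF ?addn0 //=.
by rewrite sorted_notin ?E.
Qed.

(** [num_ext] chooses the valley [x] before the peak, whereas [child_sum] is arranged by the
    truncation [j]; the sums are exchanged. *)
Lemma child_sumE g w :
  child_sum g w = \sum_(0 <= x < (size w).+1) \sum_(0 <= j < (size w).+2)
    (x <= j) && sorted implb (drop x (take j (rcons w true)))
      * g (insert x (take j (rcons w true))).
Proof.
rewrite exchange_big_nat /= big_nat_recr //= addnC; congr (_ + _).
  rewrite /row2_sum size_rcons big_ord_recr /=.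
  rewrite [drop _.+1 _]drop_oversize ?size_rcons //= addn0 big_mkord.
  rewrite take_oversize ?size_rcons //; apply: eq_bigr => x _.
  have Hx : x <= size w by rewrite -ltnS.
  by rewrite drop_rcons // mem_rcons inE /= andbT (leqW Hx).
rewrite big_mkord; apply: eq_bigr => j _; rewrite row_sumD.
have Hj : j <= size w by rewrite -ltnS.
rewrite -[in RHS]cats1 takel_cat //.
rewrite (@big_cat_nat _ _ _ j.+1 0 (size w).+1) //= [X in _ = _ + X]big1_seq ?addn0.
  rewrite size_takel //; apply: eq_big_nat => x Hx.
  by have -> : x <= j by lia.
move=> x; rewrite mem_index_iota => Hx.
by have -> : (x <= j) = false by lia.
Qed.

Lemma has123_head q c : ~~ has123 q (perm_of_code c) -> ~~ has123 q.+1 (perm_of_code (q :: c)).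
Proof. by move=> H; rewrite [perm_of_code _]/= has123_cons_lt // has12_empty. Qed.

Lemma extendable_cons y c x : extendable (y :: c) x =
  ~~ has123 x (perm_of_code (y :: c)) && (if odd (size c) then x <= y else y < x).
Proof. by rewrite /extendable /=; case: (odd _). Qed.

Lemma extendable_valley q c x : odd (size c) -> ~~ has123 q (perm_of_code c) ->
  extendable (q :: c) x = (x <= q).
Proof.
move=> Ho /has123_head H3; rewrite extendable_cons Ho.
have [Hx|] := leqP x q; last by rewrite andbF.
by rewrite andbT; apply: contra H3; apply: has123_le; apply: leqW.
Qed.

(** If j > q+1, then [x], the old peak and the next larger value, which lies to its right, form a
    123 below the new peak. Otherwise there is no 123 below [j] before [x] is prepended, and only a
    12 at or above [x] can obstruct. *)
Lemma extendable_peak q c x j : is_code (q :: c) -> odd (size c) ->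
    ~~ has123 q (perm_of_code c) -> x <= q -> j <= (size c).+1 ->
  extendable (x :: q :: c) j.+1
    = (j <= q.+1) && ((x <= j) && sorted implb (drop x (take j (word_of_code (q :: c))))).
Proof.
move=> Hc Ho H3 Hx Hj; rewrite extendable_cons (perm_of_code_cons x) [odd _]/= Ho.
rewrite ltnS; have [Hxj|] := leqP x j; last by rewrite !andbF.
rewrite has123_cons_lt // andbT.
have [Hjq|Hjq] := leqP j q.+1.
  have H : ~~ has123 j (perm_of_code (q :: c)).
    by apply: contra (has123_head H3); apply: has123_le.
  by rewrite (negbTE H) orbF has12_word_of_code // negbK.
apply/negbTE; rewrite negbK; apply/orP; left => /=.
rewrite Hx; apply/orP; left; apply/hasP; exists q.+1; last by lia.
have := @mem_perm_of_code (q :: c) q.+1 Hc; rewrite perm_of_code_cons inE [size _]/=.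
by have -> : (q.+1 == q) = false by [lia]; rewrite /= => ->; lia.
Qed.

Lemma take_word_of_code_head q c : q <= size c ->
  take q.+1 (word_of_code (q :: c)) = rcons (take q (word_of_code c)) true.
Proof.
move=> Hq; rewrite [word_of_code _]/= take_insert ?size_word_of_code //.
by rewrite -[X in insert X _](@size_takel q _ (word_of_code c)) ?size_word_of_code // insert_size.
Qed.

Lemma sum_leq_nat (F : nat -> nat) q n : q < n ->
  \sum_(0 <= x < n) (x <= q) * F x = \sum_(0 <= x < q.+1) F x.
Proof.
move=> Hq; rewrite (@big_cat_nat _ _ _ q.+1) //= [X in _ + X]big1_seq ?addn0.
  by apply: eq_big_nat => x Hx; have -> : x <= q by [lia]; rewrite mul1n.
move=> x; rewrite mem_index_iota => Hx.
by have -> : (x <= q) = false by lia.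
Qed.

(** Only the values below the current peak [q] matter for what can be prepended, so the truncated
    word is a sufficient state. Odd [size c] makes [q] a peak, and having no 123 below it is
    preserved by each double step. *)
Lemma num_ext_num_desc k q c : is_code (q :: c) -> odd (size c) ->
  ~~ has123 q (perm_of_code c) ->
  num_ext k.*2.+1 (q :: c) = num_desc k (take q (word_of_code c)).
Proof.
elim: k q c => [|k IH] q c Hqc Ho H3;
  have /andP[Hq Hc] : (q <= size c) && is_code c := Hqc.
  rewrite /= (eq_bigr (fun x => (x <= q) * 1)); last first.
    by move=> x _; rewrite extendable_valley.
  by rewrite sum_leq_nat ?ltnS ?(leqW Hq) // sum_nat_const_nat muln1 subn0 size_takel
    ?size_word_of_code.
rewrite doubleS num_extS.
under eq_bigr => x _ do rewrite extendable_valley //.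
rewrite sum_leq_nat ?ltnS ?(leqW Hq) // [RHS]/= child_sumE size_takel ?size_word_of_code //.
apply: eq_big_nat => x /andP[_ Hx].
(* The value 0 never lies above the valley; the other candidates for the peak are [j.+1]. *)
rewrite num_extS big_nat_recl // {1}extendable_cons [odd _]/= Ho ltn0 andbF mul0n add0n.
transitivity (\sum_(0 <= j < (size c).+2) (j <= q.+1) *
  (((x <= j) && sorted implb (drop x (take j (rcons (take q (word_of_code c)) true))))
   * num_desc k (insert x (take j (rcons (take q (word_of_code c)) true))))).
  apply: eq_big_nat => j /andP[_ Hj]; rewrite extendable_peak //.
  have [Hjq|//] := leqP j q.+1.
  have [Hxj|] := leqP x j; last by rewrite !mul0n muln0.
  rewrite -take_word_of_code_head // take_takel // mul1n.
  case E : (sorted _ _); rewrite ?mul0n // !mul1n.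
  have /andP[H _] : extendable (x :: q :: c) j.+1.
    by rewrite extendable_peak // Hjq Hxj E.
  have Hcode : is_code [:: j.+1, x, q & c].
    by rewrite /= Hc Hq !andbT; lia.
  have Hodd : odd (size [:: x, q & c]) by rewrite /= negbK.
  rewrite (IH _ _ Hcode Hodd H) (word_of_code_cons x) take_insert //.
  by rewrite size_word_of_code /=; lia.
by rewrite sum_leq_nat.
Qed.

Lemma num_ext_total n : 0 < n -> num_ext n.*2.+1 [::] = num_yam n.+1 n n.-1.
Proof.
case: n => // n _; rewrite doubleS.
(* The last peak and the last valley must have the pattern [[:: 1; 0]]. Below the peak lies one
   value, with the word [[:: true]], the only one of shape (1, 0). *)
transitivity (num_ext n.*2.+1 [:: 1; 0]).
  rewrite num_extS big_nat1 num_extS big_nat_recl // big_nat1.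
  have -> : extendable [::] 0 = true by [].
  have -> : extendable [:: 0] 0 = false by [].
  have -> : extendable [:: 0] 1 = true by [].
  by rewrite !mul1n.
rewrite num_ext_num_desc //.
have := @bsum_num_desc n 1 0 isT; rewrite bsum_rec // bsum00 addn0 add1n add0n => ->.
by rewrite (@num_yam_out _ n) ?addn0 // ltnn.
Qed.

(** * From codes to alternating permutations *)

Fixpoint good_code (c : seq nat) : bool :=
  if c is x :: c' then [&& x <= size c', extendable c' x & good_code c'] else true.

Lemma good_code_cons x c :
  good_code (x :: c) = [&& x <= size c, extendable c x & good_code c].
Proof. by []. Qed.

Fixpoint codes (m : nat) : seq (seq nat) :=
  if m is m'.+1 then
    [seq x :: c | c <- codes m',
                  x <- [seq x <- index_iota 0 (size c).+1 | extendable c x]]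
  else [:: [::]].

Lemma codesS m : codes m.+1 =
  [seq x :: c | c <- codes m,
                x <- [seq x <- index_iota 0 (size c).+1 | extendable c x]].
Proof. by []. Qed.

Lemma mem_codes m c : (c \in codes m) = good_code c && (size c == m).
Proof.
elim: m c => [|m IH] [|x c] //.
- by rewrite inE andbF.
- by rewrite codesS; apply/allpairsPdep => -[? [? []]].
rewrite codesS good_code_cons [size _]/= eqSS; apply/allpairsPdep/idP.
  case=> c' [x' [Hc' Hx' [-> ->]]]; move: Hc' Hx'.
  rewrite IH mem_filter mem_index_iota ltnS => /andP[H1 H2] /and3P[H3 _ H4].
  by rewrite H2 andbT; apply/and3P.
case/andP=> /and3P[H1 H2 H3] H4; exists c, x; rewrite IH H3 H4.
by rewrite mem_filter mem_index_iota H2 ltnS H1.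
Qed.

Lemma uniq_codes m : uniq (codes m).
Proof.
elim: m => // m IH; rewrite codesS; apply: allpairs_uniq_dep => //.
  by move=> c _; rewrite filter_uniq // iota_uniq.
by move=> [c x] [c' x'] _ _ /= [-> ->].
Qed.

Lemma sum_num_ext_codes r m : \sum_(c <- codes m) num_ext r c = size (codes (m + r)).
Proof.
elim: r m => [|r IH] m; first by rewrite addn0 sum1_size.
rewrite addnS -addSn -IH codesS big_allpairs_dep; apply: eq_bigr => c _.
rewrite num_extS big_filter [RHS]big_mkcond; apply: eq_bigr => x _.
by case: (extendable c x); rewrite ?mul1n.
Qed.

Lemma size_codes m : size (codes m) = num_ext m [::].
Proof. by rewrite -[m in LHS]add0n -sum_num_ext_codes big_seq1. Qed.

(** Parity is counted from the right end, so that prepending an entry does not affect the earlier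
    conditions. *)
Fixpoint alternates (p : seq nat) : bool :=
  if p is x :: p' then
    (if p' is y :: _ then if odd (size p') then y < x else x < y else true)
    && alternates p'
  else true.

Lemma alternates_map (f : nat -> nat) p :
  {mono f : x y / x < y} -> alternates (map f p) = alternates p.
Proof.
move=> Hf; elim: p => //= x p ->; congr (_ && _).
by case: p => //= y p; rewrite size_map !Hf.
Qed.

(** A new 4123 must start with the prepended [x], so avoidance is decided entry by entry;
    [x < bump x y] amounts to [x <= y]. *)
Lemma good_codeE c :
  good_code c = [&& is_code c, ~~ has4123 (perm_of_code c) & alternates (perm_of_code c)].
Proof.
elim: c => // x c IH.
rewrite good_code_cons perm_of_code_cons /= IH (has4123_map _ (@ltn_bump x)).
rewrite (alternates_map _ (@ltn_bump x)) negb_or /extendable.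
rewrite (@has123_map (bump x) x x); first last.
- by move=> y; rewrite /bump; lia.
- exact: ltn_bump.
have -> : (if map (bump x) (perm_of_code c) is y :: _ then
    if odd (size (map (bump x) (perm_of_code c))) then y < x else x < y else true)
  = (if c is y :: _ then if odd (size c) then y < x else x <= y else true).
  case: c {IH} => //= y c; rewrite !size_map size_perm_of_code.
  by case: ifP => _; rewrite /bump; lia.
by case: (x <= _); case: (is_code c); case: has123; case: has4123; case: alternates; rewrite /=
  ?andbT ?andbF.
Qed.

Lemma perm_of_code_inj : injective perm_of_code.
Proof.
elim=> [|x c IH] [|y d] //= [-> /(inj_map (@bump_inj y)) /IH ->] //.
Qed.

Lemma perm_of_code_onto p : uniq p -> all (gtn (size p)) p ->
  exists2 c, is_code c & perm_of_code c = p.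
Proof.
move E : (size p) => m; elim: m p E => [|m IH] [|x p] //=; first by exists [::].
move=> [Hm] /andP[Hx Up] /andP[Hxm Hp].
have Ep : p = map (bump x) (map (unbump x) p).
  rewrite -map_comp -[LHS]map_id; apply/eq_in_map => y Hy /=.
  by rewrite unbumpK // inE; apply: contraNneq Hx => <-.
have [|||c Hc Ec] := IH (map (unbump x) p).
- by rewrite size_map.
- by rewrite Ep (map_inj_uniq (@bump_inj x)) in Up.
- apply/allP => y /mapP[z Hz ->] /=; have := allP Hp z Hz.
  have : z != x by apply: contraNneq Hx => <-.
  by rewrite /= /unbump; lia.
exists (x :: c); rewrite /= ?Hc ?Ec -?Ep // andbT.
by rewrite -size_perm_of_code Ec size_map Hm.
Qed.

Lemma has12_nthP lo hi p : reflect
  (exists i j, [/\ i < j < size p, lo <= nth 0 p i, nth 0 p i < nth 0 p j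
                  & nth 0 p j < hi]) (has12 lo hi p).
Proof.
elim: p => [|y p IH] /=; first by apply: ReflectF => -[i [j []]]; rewrite ltn0 andbF.
apply: (iffP orP) => [[/andP[Hlo /(has_nthP 0)[j Hj /andP[H1 H2]]]|/IH[i [j [H1 H2 H3 H4]]]]|].
- by exists 0, j.+1.
- by exists i.+1, j.+1.
case=> i [j []]; case: i j => [|i] [|j]; rewrite ?ltn0 //= => H1 H2 H3 H4.
  left; rewrite H2; apply/(has_nthP 0); exists j => //.
  by rewrite H3.
by right; apply/IH; exists i, j.
Qed.

Lemma has123_nthP hi p : reflect
  (exists i j k, [/\ i < j, j < k, k < size p, nth 0 p i < nth 0 p j
     & nth 0 p j < nth 0 p k < hi]) (has123 hi p).
Proof.
elim: p => [|y p IH] /=; first by apply: ReflectF => -[i [j [k []]]].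
apply: (iffP orP) => [[/has12_nthP[i [j [/andP[H1 H2] H3 H4 H5]]]|/IH[i [j [k [H1 H2 H3 H4
  H5]]]]]|].
- by exists 0, i.+1, j.+1; split=> //=; rewrite H4.
- by exists i.+1, j.+1, k.+1.
case=> i [j [k []]]; case: i j k => [|i] [|j] [|k]; rewrite ?ltn0 //= => H1 H2 H3 H4 /andP[H5 H6].
  by left; apply/has12_nthP; exists j, k; split=> //; rewrite -ltnS H2.
by right; apply/IH; exists i, j, k; split=> //; rewrite H5.
Qed.

Lemma has4123_nthP p : reflect
  (exists h i j k, [/\ h < i < j, j < k < size p, nth 0 p i < nth 0 p j
     & nth 0 p j < nth 0 p k < nth 0 p h]) (has4123 p).
Proof.
elim: p => [|y p IH] /=.
  by apply: ReflectF => -[h [i [j [k []]]]]; rewrite ltn0 andbF.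
apply: (iffP orP) => [[/has123_nthP[i [j [k [H1 H2 H3 H4 H5]]]]|/IH[h [i [j [k [H1 H2 H3 H4]]]]]]|].
- by exists 0, i.+1, j.+1, k.+1; split=> //=; rewrite ltnS H2.
- by exists h.+1, i.+1, j.+1, k.+1.
case=> h [i [j [k []]]]; case: h i j k => [|h] [|i] [|j] [|k]; rewrite ?ltn0 ?andbF //= => H1 H2 H3
  H4.
  by left; apply/has123_nthP; exists i, j, k; case/andP: H2.
by right; apply/IH; exists h, i, j, k.
Qed.

Lemma alternatesP p : reflect
  (forall i, i.+1 < size p ->
     if odd (size p - i.+1) then nth 0 p i.+1 < nth 0 p i
     else nth 0 p i < nth 0 p i.+1) (alternates p).
Proof.
elim: p => [|x p IH]; first by apply: ReflectT.
apply: (iffP andP) => [[H /IH Hp] [|i] /= Hi|H].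
- by rewrite subn1 /=; case: p H Hi {IH Hp}.
- by rewrite subSS; apply: Hp.
split; last by apply/IH => i Hi; have := H i.+1 Hi; rewrite subSS.
by case: p H {IH} => // y p /(_ 0 isT); rewrite subn1.
Qed.

Definition perm_values (m : nat) (p : {perm 'I_m}) : seq nat :=
  [seq val (p i) | i <- enum 'I_m].

Lemma size_perm_values m (p : {perm 'I_m}) : size (perm_values p) = m.
Proof. by rewrite size_map size_enum_ord. Qed.

Lemma nth_perm_values m (p : {perm 'I_m}) (i : 'I_m) :
  nth 0 (perm_values p) i = p i.
Proof. by rewrite (nth_map i) ?size_enum_ord ?nth_ord_enum. Qed.

Lemma perm_values_inj m : injective (@perm_values m).
Proof.
move=> p q E; apply/permP => i; apply: val_inj.
by rewrite /= -!nth_perm_values E.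
Qed.

Lemma avoids4123E m (p : {perm 'I_m}) :
  avoids4123 p = ~~ has4123 (perm_values p).
Proof.
congr (~~ _); apply/idP/has4123_nthP; last first.
  case=> h [i [j [k [/andP[H1 H2] /andP[H3 H4]]]]].
  rewrite size_perm_values in H4 => H5 /andP[H6 H7].
  have Hj := ltn_trans H3 H4; have Hi := ltn_trans H2 Hj; have Hh := ltn_trans H1 Hi.
  apply/existsP; exists (Ordinal Hh); apply/existsP; exists (Ordinal Hi).
  apply/existsP; exists (Ordinal Hj); apply/existsP; exists (Ordinal H4).
  by rewrite H1 H2 H3 -!nth_perm_values /= H5 H6 H7.
case/existsP=> h /existsP[i /existsP[j /existsP[k]]].
case/and5P=> H1 H2 H3 H4 /andP[H5 H6].
by exists h, i, j, k; rewrite size_perm_values !nth_perm_values; split; rewrite ?H1 ?H3 ?H5 //=.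
Qed.

(** In odd length a position has the same parity counted from either end. *)
Lemma up_downE m (p : {perm 'I_m}) : odd m ->
  up_down p = alternates (perm_values p).
Proof.
move=> Hm; apply/idP/alternatesP.
  move=> H i; rewrite size_perm_values => Hi.
  have /forallP/(_ (Ordinal Hi)) := forallP H (Ordinal (ltnW Hi)).
  rewrite /= eqxx /= -!nth_perm_values /=.
  by rewrite (oddB (ltnW Hi)) Hm /=; case: (odd i).
move=> H; apply/forallP => i; apply/forallP => j; apply/implyP => /eqP Hj.
have Hi : i.+1 < m by rewrite -Hj.
have := H i; rewrite size_perm_values => /(_ Hi).
rewrite (oddB (ltnW Hi)) Hm /= -Hj !nth_perm_values.
by case: (odd i).
Qed.

Lemma perm_values_onto m (l : seq nat) : size l = m.+1 -> uniq l ->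
  all (gtn m.+1) l -> exists p : {perm 'I_m.+1}, perm_values p = l.
Proof.
move=> Hs Hu Ha; pose f (i : 'I_m.+1) : 'I_m.+1 := inord (nth 0 l i).
have fE i : f i = nth 0 l i :> nat.
  by rewrite inordK //; apply: (allP Ha); apply: mem_nth; rewrite Hs.
have f_inj : injective f.
  move=> i j /(congr1 val); rewrite /= !fE => /eqP.
  by rewrite nth_uniq ?Hs // => /eqP/val_inj.
exists (perm f_inj); apply: (@eq_from_nth _ 0); first by rewrite size_perm_values.
rewrite size_perm_values => i Hi.
by rewrite (@nth_perm_values _ _ (Ordinal Hi)) permE fE.
Qed.

Lemma card_UD4123 m : ~~ odd m -> #|UD4123 m.+1| = num_ext m.+1 [::].
Proof.
move=> Hm; rewrite -size_codes cardE -(size_map (@perm_values m.+1)) -(size_map perm_of_code (codes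
  _)).
apply: perm_size; apply: uniq_perm.
- by rewrite (map_inj_uniq (@perm_values_inj _)) enum_uniq.
- by rewrite (map_inj_uniq perm_of_code_inj) uniq_codes.
move=> l; apply/mapP/mapP => -[].
  move=> p; rewrite mem_enum inE up_downE // avoids4123E => /andP[H1 H2 El].
  have [||c Hc Ec] := @perm_of_code_onto l.
  - by rewrite El map_inj_uniq ?enum_uniq // => i j /val_inj/perm_inj.
  - by rewrite El size_perm_values; apply/allP => y /mapP[i _ ->] /=.
  exists c; rewrite // mem_codes good_codeE Hc Ec El H1 H2.
  by rewrite -size_perm_of_code Ec El size_perm_values eqxx.
move=> c; rewrite mem_codes good_codeE => /andP[/and3P[H1 H2 H3] /eqP Hs] El.
have [|||p Hp] := @perm_values_onto m l.
- by rewrite El size_perm_of_code.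
- by rewrite El uniq_perm_of_code.
- by apply/allP => y; rewrite El mem_perm_of_code // Hs.
by exists p; rewrite // mem_enum inE up_downE // avoids4123E Hp El H2 H3.
Qed.

(** * Standard Young tableaux as lattice words *)

Fixpoint yamanouchi (w : seq nat) : bool :=
  if w is x :: w' then
    [&& x < 3, count_mem 1 w <= count_mem 0 w, count_mem 2 w <= count_mem 1 w
      & yamanouchi w']
  else true.

Lemma mem_yam_words m a b c w : m = a + b + c ->
  (w \in yam_words m a b c) = [&& yamanouchi w, count_mem 0 w == a,
                            count_mem 1 w == b & count_mem 2 w == c].
Proof.
elim: m a b c w => [|m IH] a b c w Hm.
  have [-> [-> ->]] : a = 0 /\ b = 0 /\ c = 0 by lia.
  rewrite inE; case: w => // x w; apply/esym/negbTE/negP => /and4P[/= /andP[Hx _]].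
  by case: x Hx => [|[|[|x]]].
rewrite [yam_words _ _ _ _]/=.
case: w => [|x w].
  have -> : [&& yamanouchi [::], count_mem 0 [::] == a, count_mem 1 [::] == b & count_mem 2 [::] ==
    c] = false by rewrite /=; lia.
  case: ifP => // _; rewrite !mem_cat.
  by case: a {Hm} => [|a]; case: b => [|b]; case: c => [|c]; rewrite ?in_nil ?orbF //=;
    apply/negP; do ?[case/orP]; case/mapP.
have mapE y s : (x :: w \in [seq y :: v | v <- s]) = (x == y) && (w \in s).
  apply/mapP/andP => [[v Hv [-> ->]] //|[/eqP -> Hw]]; by exists w.
case: ifP => [/andP[H1 H2]|H]; last first.
  apply/esym/negbTE/negP => /and4P[/= /and4P[_ Ha Hb _] /eqP Ea /eqP Eb /eqP Ec].
  by move: H; rewrite -Ea -Eb -Ec Ha Hb.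
rewrite !mem_cat.
have -> : (x :: w \in (if a is a'.+1 then [seq 0 :: v | v <- yam_words m a' b c] else [::]))
   = [&& x == 0, 0 < a & w \in yam_words m a.-1 b c].
  by case: a {Hm H2} => [|a]; rewrite ?andbF // mapE.
have -> : (x :: w \in (if b is b'.+1 then [seq 1 :: v | v <- yam_words m a b' c] else [::]))
   = [&& x == 1, 0 < b & w \in yam_words m a b.-1 c].
  by case: b {Hm H1 H2} => [|b]; rewrite ?andbF // mapE.
have -> : (x :: w \in (if c is c'.+1 then [seq 2 :: v | v <- yam_words m a b c'] else [::]))
   = [&& x == 2, 0 < c & w \in yam_words m a b c.-1].
  by case: c {Hm H1} => [|c]; rewrite ?andbF // mapE.
case: x {mapE} => [|[|[|x]]] /=; rewrite ?orbF //.
- case: a Hm H2 => [|a] Hm H2 /=; first by rewrite andbF.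
  rewrite IH; last lia.
  by case: (yamanouchi w) => /=; lia.
- case: b Hm H1 H2 => [|b] Hm H1 H2 /=; first by rewrite !andbF.
  rewrite IH; last lia.
  by case: (yamanouchi w) => /=; lia.
- case: c Hm H1 => [|c] Hm H1 /=; first by rewrite !andbF.
  rewrite IH; last lia.
  by case: (yamanouchi w) => /=; lia.
Qed.

Lemma uniq_yam_words m a b c : uniq (yam_words m a b c).
Proof.
elim: m a b c => [|m IH] a b c /=; first by case: ifP.
case: ifP => // _.
have consI (x : nat) : injective (cons x) by move=> u v [].
have disj (x y : nat) s t : x != y ->
    ~~ has (mem [seq x :: w | w <- s]) [seq y :: w | w <- t].
  move=> Hxy; apply/hasP => -[_ /mapP[u _ ->] /= /mapP[v _ [E _]]].
  by rewrite E eqxx in Hxy.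
have nilE (s : seq (seq nat)) : ~~ has (mem [::]) s by apply/hasP => -[].
case: a b c => [|a] [|b] [|c]; rewrite ?cats0 ?cat_uniq ?has_cat ?negb_or;
  by rewrite ?(map_inj_uniq (consI _)) ?IH ?disj ?nilE.
Qed.

Lemma yamanouchi_count w : yamanouchi w ->
  (count_mem 1 w <= count_mem 0 w) && (count_mem 2 w <= count_mem 1 w).
Proof. by case: w => // x w /and4P[_ -> ->]. Qed.

Lemma yamanouchi_drop k w : yamanouchi w -> yamanouchi (drop k w).
Proof.
elim: w k => [|x w IH] [|k] // /and4P[_ _ _ H]; exact: IH.
Qed.

Lemma yamanouchi_all w : yamanouchi w -> all (gtn 3) w.
Proof. by elim: w => // x w IH /and4P[Hx _ _ /IH Hw]; apply/andP. Qed.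

Lemma yamanouchi_prefix k u i j : yamanouchi (rev u) -> i < j < 3 ->
  count_mem j (take k u) <= count_mem i (take k u).
Proof.
move=> H Hij; have := yamanouchi_drop (size u - k) H; rewrite drop_rev.
have -> : take (size u - (size u - k)) u = take k u.
  have [Hk|Hk] := leqP k (size u); first by rewrite subKn.
  by rewrite (eqP (ltnW Hk)) subn0 take_size take_oversize // ltnW.
move/yamanouchi_count; rewrite !count_rev.
by case: i j Hij => [|[|i]] [|[|[|j]]] Hij; lia.
Qed.

Lemma box_inj sh (b c : box sh) :
  box_row b = box_row c -> box_col b = box_col c -> b = c.
Proof.
case: b c => [i x] [j y]; rewrite /box_row /box_col /= => /val_inj E.
by move: x y; rewrite E => x y /val_inj ->.
Qed.

Lemma box_exists sh i j : i < size sh -> j < nth 0 sh i ->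
  exists2 b : box sh, box_row b = i & box_col b = j.
Proof.
move=> Hi Hj; exists (existT (fun i : 'I_(size sh) => 'I_(nth 0 sh i)) (Ordinal Hi) (Ordinal Hj)) =>
  //.
Qed.

Lemma box_col_lt sh (b : box sh) : box_col b < nth 0 sh (box_row b).
Proof. by case: b => i x; apply: ltn_ord. Qed.

Lemma box_row_lt sh (b : box sh) : box_row b < size sh.
Proof. by case: b => i x; apply: ltn_ord. Qed.

Definition entry_row (sh : seq nat) (T : filling sh) (k : nat) : nat :=
  if [pick b | T b == k :> nat] is Some b then box_row b else 0.

(** Reversed, so that the row of the largest entry comes first, as in [yam_words]. *)
Definition row_word (sh : seq nat) (T : filling sh) : seq nat :=
  rev (mkseq (entry_row T) (sumn sh)).

Section Tableau.
Variables (sh : seq nat) (T : filling sh).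
Hypothesis HT : T \in SYT sh.

Lemma SYT_onto k : k < sumn sh -> exists b, T b = k :> nat.
Proof.
move=> Hk; move: HT; rewrite inE => /and3P[/forallP/(_ (Ordinal Hk))/cards1P[b] E _ _].
by exists b; have : b \in [set b] by [rewrite set11]; rewrite -E inE => /eqP ->.
Qed.

Lemma SYT_inj : injective T.
Proof.
move=> b c E; move: HT; rewrite inE => /and3P[/forallP/(_ (T b))/cards1P[d] Ed _ _].
have Hb : b \in [set d] by rewrite -Ed inE.
have Hc : c \in [set d] by rewrite -Ed inE E.
by move: Hb Hc; rewrite !inE => /eqP -> /eqP ->.
Qed.

Lemma SYT_row b c : box_row b = box_row c -> box_col b < box_col c -> T b < T c.
Proof.
move: HT; rewrite inE => /and3P[_ /forallP/(_ b)/forallP/(_ c)/implyP H _] E1 E2.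
by apply: H; rewrite E1 eqxx.
Qed.

Lemma SYT_col b c : box_col b = box_col c -> box_row b < box_row c -> T b < T c.
Proof.
move: HT; rewrite inE => /and3P[_ _ /forallP/(_ b)/forallP/(_ c)/implyP H] E1 E2.
by apply: H; rewrite E1 eqxx.
Qed.

Lemma entry_rowE b : entry_row T (T b) = box_row b.
Proof.
rewrite /entry_row; case: pickP => [c /eqP/val_inj/SYT_inj -> //|/(_ b)].
by rewrite eqxx.
Qed.

Definition row_cols i k := [seq box_col b | b <- enum [set b | (box_row b == i) && (T b < k)]].

Lemma mem_row_cols i k j :
  reflect (exists b, [/\ box_row b = i, box_col b = j & T b < k])
          (j \in row_cols i k).
Proof.
apply: (iffP mapP) => [[b]|[b [H1 H2 H3]]].
  by rewrite mem_enum inE => /andP[/eqP H1 H2] ->; exists b.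
by exists b; rewrite // mem_enum inE H1 eqxx.
Qed.

Lemma uniq_row_cols i k : uniq (row_cols i k).
Proof.
rewrite map_inj_in_uniq ?enum_uniq // => b c.
rewrite !mem_enum !inE => /andP[/eqP H1 _] /andP[/eqP H2 _] E.
by apply: box_inj; rewrite ?H1.
Qed.

Lemma count_entry_row i k : k <= sumn sh ->
  count_mem i (mkseq (entry_row T) k) = size (row_cols i k).
Proof.
rewrite size_map -cardE; elim: k => [|k IH] Hk.
  by apply/esym/eqP; rewrite cards_eq0; apply/eqP/setP => b; rewrite !inE ltn0 andbF.
rewrite mkseqS -cats1 count_cat IH 1?ltnW //= addn0.
have [b Hb] := SYT_onto Hk; rewrite -{2}Hb entry_rowE.
rewrite [RHS](cardsD1 b) inE Hb ltnSn andbT addnC; congr (_ + _).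
apply: eq_card => c; rewrite !inE.
have [->|Hne] := eqVneq c b; first by rewrite Hb ltnn andbF.
congr (_ && _); rewrite ltnS [RHS]leq_eqVlt -Hb.
by case: eqP => // /val_inj/SYT_inj E; rewrite E eqxx in Hne.
Qed.

(** The smaller entries in the row of [b] are exactly those to its left. Thus the word determines
    columns as well as rows, which makes [row_word] injective. *)
Lemma count_row_col b :
  count_mem (box_row b) (mkseq (entry_row T) (T b)) = box_col b.
Proof.
rewrite count_entry_row; last exact: ltnW.
rewrite -[RHS](size_iota 0); apply: perm_size; apply: uniq_perm.
- exact: uniq_row_cols.
- exact: iota_uniq.
move=> j; rewrite mem_iota add0n /=; apply/mem_row_cols/idP => [[c [H1 <- H3]]|Hj].
  rewrite ltnNge leq_eqVlt; apply/negP => /orP[/eqP E|H].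
    by move: H3; rewrite (box_inj H1 (esym E)) ltnn.
  by have := SYT_row (esym H1) H; rewrite ltnNge ltnW.
have [c H1 H2] := box_exists (box_row_lt b) (ltn_trans Hj (box_col_lt b)).
by exists c; split=> //; apply: SYT_row; rewrite ?H2.
Qed.

Lemma count_row_word i : i < size sh -> count_mem i (row_word T) = nth 0 sh i.
Proof.
move=> Hi; rewrite count_rev count_entry_row // -[RHS](size_iota 0).
apply: perm_size; apply: uniq_perm.
- exact: uniq_row_cols.
- exact: iota_uniq.
move=> j; rewrite mem_iota add0n /=; apply/mem_row_cols/idP => [[c [<- <- _]]|Hj].
  exact: box_col_lt.
by have [c H1 H2] := box_exists Hi Hj; exists c.
Qed.

(** Above each box of row [j] there is a box of row [i], and it holds a smaller entry. *)
Lemma row_cols_le i j k : i < j -> nth 0 sh j <= nth 0 sh i -> j < size sh ->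
  size (row_cols j k) <= size (row_cols i k).
Proof.
move=> Hij Hs Hj; apply: uniq_leq_size; first exact: uniq_row_cols.
move=> x /mem_row_cols[b [H1 H2 H3]]; apply/mem_row_cols.
have [||c H4 H5] := @box_exists sh i x; first exact: ltn_trans Hj.
  by apply: leq_trans Hs; rewrite -H1 -H2 box_col_lt.
exists c; split=> //; apply: ltn_trans H3; apply: SYT_col; rewrite ?H2 ?H5 //.
by rewrite H4 H1.
Qed.

End Tableau.

Lemma row_word_inj sh : {in SYT sh &, injective (@row_word sh)}.
Proof.
move=> T T' HT HT' /(can_inj revK) E; apply/ffunP => b; apply: val_inj.
have Ek k : k <= sumn sh -> mkseq (entry_row T) k = mkseq (entry_row T') k.
  move=> Hk; apply/eq_in_map => i; rewrite mem_iota add0n => /andP[_ Hi].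
  have Hi' := leq_trans Hi Hk.
  by rewrite -[LHS](nth_mkseq 0 _ Hi') E nth_mkseq.
have [c Hc] := SYT_onto HT' (ltn_ord (T b)).
have Er : box_row b = box_row c.
  rewrite -(entry_rowE HT b) -(entry_rowE HT' c) Hc.
  by have := congr1 (fun u => nth 0 u (T b)) E; rewrite !nth_mkseq.
have Ec : box_col b = box_col c.
  by rewrite -(count_row_col HT b) -(count_row_col HT' c) Hc Er Ek // ltnW.
by rewrite /= -Hc (box_inj Er Ec).
Qed.

Lemma row_word_yamanouchi a b c (T : filling [:: a; b; c]) : c <= b <= a ->
  T \in SYT [:: a; b; c] -> yamanouchi (row_word T).
Proof.
move=> /andP[Hcb Hba] HT; rewrite /row_word.
have : sumn [:: a; b; c] <= sumn [:: a; b; c] by [].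
elim: {1 3}(sumn _) => [|k IH] Hk; first by [].
have [d Hd] := SYT_onto HT Hk.
have Hs i : count_mem i (rev (mkseq (entry_row T) k.+1)) = size (row_cols T i k.+1).
  by rewrite count_rev count_entry_row.
have H := Hs; move: H; rewrite mkseqS rev_rcons => H.
apply/and4P; split; rewrite ?H.
- by rewrite -Hd entry_rowE // box_row_lt.
- exact: row_cols_le.
- exact: row_cols_le.
by apply: IH; apply: ltnW.
Qed.

Lemma occurrence i j u : j < count_mem i u ->
  exists k, [/\ k < size u, nth 0 u k = i & count_mem i (take k u) = j].
Proof.
elim: u j => //= x u IH j; case: eqP => [->|Hx].
  case: j => [|j]; first by exists 0.
  by rewrite add1n ltnS => /IH[k [H1 H2 H3]]; exists k.+1; rewrite /= eqxx H3.
rewrite add0n => /IH[k [H1 H2 H3]]; exists k.+1; rewrite /= H3; split=> //.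
by case: eqP.
Qed.

Lemma count_take_le (i k l : nat) (u : seq nat) : k <= l ->
  count_mem i (take k u) <= count_mem i (take l u).
Proof.
move=> H; rewrite -(subnKC H) takeD count_cat; exact: leq_addr.
Qed.

Lemma count_take_lt k l u : k < l -> k < size u ->
  count_mem (nth 0 u k) (take k u) < count_mem (nth 0 u k) (take l u).
Proof.
move=> H Hk; apply: leq_trans (count_take_le _ _ H).
by rewrite (take_nth 0 Hk) -cats1 count_cat /= eqxx addn1.
Qed.

Lemma row_word_onto a b c w : yamanouchi w -> count_mem 0 w = a ->
    count_mem 1 w = b -> count_mem 2 w = c ->
  exists2 T, T \in SYT [:: a; b; c] & row_word T = w.
Proof.
move=> Yw Ha Hb Hc; set sh := [:: a; b; c].
pose u := rev w; have Yu : yamanouchi (rev u) by rewrite revK.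
have Hu i : i < 3 -> count_mem i u = nth 0 sh i.
  by rewrite count_rev; case: i => [|[|[|i]]] //.
have Hlt k : k < size u -> nth 0 u k < 3.
  move=> Hk; apply: (allP (yamanouchi_all Yw)).
  by rewrite -[w]revK mem_rev mem_nth.
have Hsize : size u = sumn sh.
  rewrite /sh -Ha -Hb -Hc /= addn0 size_rev.
  elim: w Yw {Ha Hb Hc sh u Yu Hu Hlt} => //= x w IH /and4P[Hx _ _ /IH ->].
  by case: x Hx => [|[|[|x]]] //= _; lia.
(* The box in row i and column j receives the position of the letter i that has exactly j earlier
   letters i. *)
have P (d : box sh) : exists k : 'I_(sumn sh),
    (nth 0 u k == box_row d) && (count_mem (box_row d) (take k u) == box_col d).
  have [|k [H1 H2 H3]] := @occurrence (box_row d) (box_col d) u.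
    by rewrite Hu ?box_col_lt // box_row_lt.
  by rewrite Hsize in H1; exists (Ordinal H1); rewrite /= H2 H3 !eqxx.
pose T : filling sh := [ffun d => xchoose (P d)].
have TP d : nth 0 u (T d) = box_row d /\ count_mem (box_row d) (take (T d) u) = box_col d.
  by rewrite ffunE; have /andP[/eqP -> /eqP ->] := xchooseP (P d).
have Tlt d : T d < size u by rewrite Hsize.
have Tinj : injective T.
  move=> d e E; have [H1 H2] := TP d; have [H3 H4] := TP e.
  by apply: box_inj; rewrite -?H1 -?H3 -?H2 -?H4 E // -H1 -H3 E.
have Tonto (k : 'I_(sumn sh)) : exists d, T d = k.
  have Hk : k < size u by rewrite Hsize.
  have [||d H1 H2] := @box_exists sh (nth 0 u k) (count_mem (nth 0 u k) (take k u)).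
  - exact: Hlt.
  - by rewrite -(Hu _ (Hlt _ Hk)); have := count_take_lt Hk Hk; rewrite take_size.
  exists d; have [H3 H4] := TP d; apply: val_inj => /=.
  rewrite H1 in H3; rewrite H1 H2 in H4.
  have [H|H|//] := ltngtP (T d) k.
    by have := count_take_lt H (Tlt d); rewrite H3 H4 ltnn.
  by have := count_take_lt H Hk; rewrite H4 ltnn.
have HT : T \in SYT sh.
  rewrite inE; apply/and3P; split.
  - apply/forallP => k; apply/cards1P; have [d Hd] := Tonto k; exists d.
    by apply/setP => e; rewrite !inE -Hd (inj_eq Tinj).
  - apply/forallP => d; apply/forallP => e; apply/implyP => /andP[/eqP E Hlt'].
    have [H1 H2] := TP d; have [H3 H4] := TP e.
    rewrite ltnNge; apply/negP => H; have := count_take_le (box_row d) u H.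
    by rewrite H2 E H4 leqNgt Hlt'.
  apply/forallP => d; apply/forallP => e; apply/implyP => /andP[/eqP E Hlt'].
  have [H1 H2] := TP d; have [H3 H4] := TP e.
  rewrite ltnNge leq_eqVlt; apply/negP => /orP[/eqP/val_inj/Tinj Ed|H].
    by rewrite Ed ltnn in Hlt'.
  (* Through position [T e] there are more than [box_col e] letters of the row of [e], hence also of
     the row of [d]; but before the later position [T d] there are only [box_col d] of the
     latter. *)
  have := count_take_lt (ltnSn (T e)) (Tlt e); rewrite H3 H4 => H5.
  have Hr : box_row d < box_row e < 3 by rewrite Hlt' box_row_lt.
  have := leq_trans H5 (@yamanouchi_prefix (T e).+1 u _ _ Yu Hr).
  by rewrite ltnNge -E -H2 count_take_le.
exists T => //; rewrite /row_word -[RHS]revK -/u; congr rev.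
apply: (@eq_from_nth _ 0); rewrite size_mkseq ?Hsize // => k Hk.
rewrite nth_mkseq //; have [d Hd] := Tonto (Ordinal Hk).
have -> : k = T d by rewrite Hd.
by rewrite entry_rowE //; case: (TP d).
Qed.

Lemma card_SYT a b c : c <= b <= a -> #|SYT [:: a; b; c]| = num_yam a b c.
Proof.
move=> H; rewrite cardE -(size_map (@row_word _)).
apply: perm_size; apply: uniq_perm.
- rewrite map_inj_in_uniq ?enum_uniq // => T T'; rewrite !mem_enum; exact: row_word_inj.
- exact: uniq_yam_words.
move=> w; rewrite mem_yam_words //; apply/mapP/and4P => [[T]|[H1 /eqP H2 /eqP H3 /eqP H4]].
  rewrite mem_enum => HT ->; split; first exact: row_word_yamanouchi.
  - by rewrite count_row_word.
  - by rewrite count_row_word.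
  - by rewrite count_row_word.
by have [T HT <-] := row_word_onto H1 H2 H3 H4; exists T; rewrite ?mem_enum.
Qed.

(** * Equal cardinalities and the resulting bijection *)

Theorem theorem3p2 (n : nat) (hn : 1 <= n) :
  exists f : {p | p \in UD4123 (2 * n).+1} ->
             {T | T \in SYT [:: n.+1; n; n.-1]},
    bijective f.
Proof.
have E : #|{: {p | p \in UD4123 (2 * n).+1}}| = #|{: {T | T \in SYT [:: n.+1; n; n.-1]}}|.
  rewrite !card_sig card_SYT; last by lia.
  by rewrite -num_ext_total // -mul2n -card_UD4123 // mul2n odd_double.
exists (fun x => enum_val (cast_ord E (enum_rank x))).
exists (fun y => enum_val (cast_ord (esym E) (enum_rank y))) => x.
  by rewrite enum_valK cast_ordK enum_rankK.
by rewrite enum_valK cast_ordKV enum_rankK.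
Qed.
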